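(* For any graph $G$ we have that $$\nu^{=}(G)=\max_{a\in\mathcal{D}(G)}\mathrm{gd}(G,a).$$
   Context: Let $G=(V=[n],E)$ be a graph. $\mathcal{S}^n$ is the space of real symmetric $n\times n$ matrices with trace inner product $\langle X,Y\rangle=\mathrm{Tr}(XY)$, $\mathcal{S}^n_+$ the cone of positive semidefinite (psd) matrices, and $X\succeq 0$ means $X$ is psd. $E_{ij}=(e_ie_j^{T}+e_je_i^{T})/2$ with $e_1,\dots,e_n$ the standard unit vectors. $V$ is identified with the set of diagonal pairs $\{i,i\}$; $\overline{E}$ is the set of pairs $\{i,j\}$ with $i\neq j$, $\{i,j\}\notin E$. $\mathcal{C}(G)=\{X\in\mathcal{S}^n:\langle E_{ij},X\rangle=0\ \forall\{i,j\}\in\overline{E}\}$. $\mathrm{lin}$ denotes linear span. The corank of a matrix is the dimension of its kernel. $\mathcal{S}_+(G)$ is the set of $G$-partial psd matrices, i.e. vectors $a\in\mathbb{R}^{V\cup E}$ for which there is $X\in\mathcal{S}^n_+$ with $X_{ij}=a_{ij}$ for all $\{i,j\}\in V\cup E$. For $a\in\mathcal{S}_+(G)$, the Gram dimension $\mathrm{gd}(G,a)$ is the smallest integer $k\ge1$ for which there exist $p_1,\dots,p_n\in\mathbb{R}^k$ with $p_i^{T}p_j=a_{ij}$ for all $\{i,j\}\in V\cup E$. For $M\in\mathcal{S}^n$ of rank $r$ with spectral decomposition $M=Q\Lambda Q^{T}$ ($Q$ orthogonal, $\Lambda$ diagonal with $\Lambda_{ii}\neq0$ exactly for $i\in[r]$),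 set $$\mathcal{T}_M=\left\{Q\begin{pmatrix}U&W\\ W^{T}&0\end{pmatrix}Q^{T}:U\in\mathcal{S}^r,\ W\in\mathbb{R}^{r\times(n-r)}\right\}.$$ $M\in\mathcal{C}(G)$ satisfies the Strong Arnold Property (SAP) if $\mathcal{T}_M+\mathrm{lin}\{E_{ij}:\{i,j\}\in V\cup E\}=\mathcal{S}^n$. The parameter $\nu^{=}(G)$ is the maximum corank of a matrix $M\in\mathcal{C}(G)\cap\mathcal{S}^n_+$ satisfying the SAP. For $a\in\mathcal{S}_+(G)$ consider the semidefinite program $$(D_a)\quad \inf_{y,Z}\Big\{\sum_{\{i,j\}\in V\cup E}y_{ij}a_{ij}:\ \sum_{\{i,j\}\in V\cup E}y_{ij}E_{ij}=Z\succeq0\Big\},$$ which is the dual of $\sup_X\{0:\langle E_{ij},X\rangle=a_{ij}\ \text{for }\{i,j\}\in V\cup E,\ X\succeq0\}$. A feasible solution $(y,Z)$ of $(D_a)$ is (dual) nondegenerate if $\mathcal{T}_Z+\mathrm{lin}\{E_{ij}:\{i,j\}\in V\cup E\}=\mathcal{S}^n$. $\mathcal{D}(G)$ denotes the set of $a\in\mathcal{S}_+(G)$ for which $(D_a)$ has a nondegenerate optimal solution. *)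

(* Defs.v *)
From HB Require Import structures.
From mathcomp Require Import all_boot all_order all_algebra.
From mathcomp Require Import boolp classical_sets reals.

Set Implicit Arguments.
Unset Strict Implicit.
Unset Printing Implicit Defensive.

Import Order.TTheory GRing.Theory Num.Theory.
Local Open Scope classical_set_scope.
Local Open Scope ring_scope.

Definition symmx (R : realType) (n : nat) : set 'M[R]_n := [set X | X^T = X].

Definition psdmx (R : realType) (n : nat) : set 'M[R]_n :=
  [set X | X^T = X /\ forall x : 'cV[R]_n, 0 <= (x^T *m X *m x) 0 0].

(* Dimension of the row kernel of M; M is square, so this is also the dimension
   of {x | M x = 0}. *)
Definition corank (R : realType) (n : nat) (M : 'M[R]_n) : nat :=
  \rank (kermx M).

Definition Emx (R : realType) (n : nat) (i j : 'I_n) : 'M[R]_n :=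
  2^-1 *: (delta_mx i j + delta_mx j i).

Definition spectral_decomposition (R : realType) (n : nat)
    (M Q : 'M[R]_n) (d : 'rV[R]_n) : Prop :=
  [/\ Q^T *m Q = 1%:M,
      forall i : 'I_n, (d 0 i != 0) = (i < \rank M)%N
    & M = Q *m diag_mx d *m Q^T].

Definition tangent_block (R : realType) (r s : nat) (U : 'M[R]_r)
    (W : 'M[R]_(r, s)) : 'M[R]_(r + s) := block_mx U W W^T 0.

(* For symmetric M this set does not depend on the spectral decomposition used
   to define it, so that the union over all decompositions taken here is the
   set given by any one of them. The cast is along \rank M + (n - \rank M) = n. *)
Definition tangent_space (R : realType) (n : nat) (M : 'M[R]_n)
    : set 'M[R]_n :=
  [set X | exists (Q : 'M[R]_n) (d : 'rV[R]_n)
             (U : 'M[R]_(\rank M)) (W : 'M[R]_(\rank M, n - \rank M)),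
     [/\ spectral_decomposition M Q d, U^T = U
       & X = Q *m castmx (subnKC (rank_leq_row M), subnKC (rank_leq_row M))
                         (tangent_block U W) *m Q^T]].

(* Graphs on 'I_n, given by their adjacency relation e *)

(* The index set V \cup E: the pair {i, j} is represented by (i, j), i <= j. *)
Definition VE_pred (n : nat) (e : rel 'I_n) : pred ('I_n * 'I_n) :=
  fun p => (p.1 <= p.2)%N && ((p.1 == p.2) || e p.1 p.2).

Definition VE (n : nat) (e : rel 'I_n) : finType := {p : 'I_n * 'I_n | VE_pred e p}.

Definition end1 (n : nat) (e : rel 'I_n) (p : VE e) : 'I_n := (val p).1.
Definition end2 (n : nat) (e : rel 'I_n) (p : VE e) : 'I_n := (val p).2.

Definition EVE (R : realType) (n : nat) (e : rel 'I_n) (p : VE e) : 'M[R]_n :=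
  Emx R (end1 p) (end2 p).

Definition linE (R : realType) (n : nat) (e : rel 'I_n) : {vspace 'M[R]_n} :=
  <<[seq EVE R p | p : VE e]>>%VS.

Definition Cmx (R : realType) (n : nat) (e : rel 'I_n) : set 'M[R]_n :=
  [set X | X^T = X /\
           forall i j, i != j -> ~~ e i j -> \tr (Emx R i j *m X) = 0].

Definition has_SAP (R : realType) (n : nat) (e : rel 'I_n) (M : 'M[R]_n)
    : Prop :=
  [set X + Y | X in tangent_space M & Y in [set` linE R e]] = @symmx R n.

(* The set of coranks below is nonempty (it contains the corank 0 of the
   identity matrix) and bounded by n, so this is its maximum. *)
Definition nu_eq (R : realType) (n : nat) (e : rel 'I_n) : nat :=
  \max_(k < n.+1 | `[< exists M : 'M[R]_n,
     [/\ Cmx e M, psdmx M, has_SAP e M & corank M = k] >]) k.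

Definition partial_psd (R : realType) (n : nat) (e : rel 'I_n)
    : set {ffun VE e -> R} :=
  [set a | exists X : 'M[R]_n,
     psdmx X /\ forall p : VE e, X (end1 p) (end2 p) = a p].

Definition gram_representable (R : realType) (n : nat) (e : rel 'I_n)
    (a : {ffun VE e -> R}) : set nat :=
  [set k | (1 <= k)%N /\
     exists u : 'I_n -> 'cV[R]_k,
       forall p : VE e, ((u (end1 p))^T *m u (end2 p)) 0 0 = a p].

(* Smallest element of gram_representable a, which is nonempty whenever a is
   in partial_psd e; the default value 0 is only taken outside partial_psd e. *)
Definition gram_dim (R : realType) (n : nat) (e : rel 'I_n)
    (a : {ffun VE e -> R}) : nat :=
  xget 0%N [set k | gram_representable a k /\
                    forall l, gram_representable a l -> (k <= l)%N].

Definition dual_feasible (R : realType) (n : nat) (e : rel 'I_n)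
    (y : {ffun VE e -> R}) (Z : 'M[R]_n) : Prop :=
  \sum_(p : VE e) y p *: EVE R p = Z /\ psdmx Z.

(* Nondegeneracy of a dual feasible (y, Z) only involves Z. *)
Definition dual_nondegenerate (R : realType) (n : nat) (e : rel 'I_n)
    (Z : 'M[R]_n) : Prop :=
  [set X + Y | X in tangent_space Z & Y in [set` linE R e]] = @symmx R n.

Definition dual_value (R : realType) (n : nat) (e : rel 'I_n)
    (a y : {ffun VE e -> R}) : R := \sum_(p : VE e) y p * a p.

Definition dual_optimal (R : realType) (n : nat) (e : rel 'I_n)
    (a y : {ffun VE e -> R}) (Z : 'M[R]_n) : Prop :=
  dual_feasible y Z /\
  forall (y' : {ffun VE e -> R}) (Z' : 'M[R]_n),
    dual_feasible y' Z' -> dual_value a y <= dual_value a y'.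

Definition Dset (R : realType) (n : nat) (e : rel 'I_n)
    : set {ffun VE e -> R} :=
  [set a | partial_psd a /\
     exists (y : {ffun VE e -> R}) (Z : 'M[R]_n),
       dual_optimal a y Z /\ dual_nondegenerate e Z].

Definition is_max (A : set nat) (m : nat) : Prop :=
  A m /\ forall k, A k -> (k <= m)%N.

(* Main.v *)
(* Complementary slackness: the optimal value of (D_a) is 0, so an optimal Z
   satisfies Z X = 0 for every psd completion X of a, whence
   gd(G, a) <= rank X <= corank Z <= nu. Conversely, if M attains nu, then the
   Gram matrix X of a basis of ker M satisfies M X = 0. The SAP of M says that
   no nonzero symmetric Y vanishing on V and E has M Y = 0, so X is the only
   psd completion of its own restriction a, and gd(G, a) = rank X = nu. *)
Require Import Defs.
From mathcomp Require Import all_boot all_order all_algebra.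
From mathcomp Require Import boolp classical_sets reals.

Set Implicit Arguments.
Unset Strict Implicit.
Unset Printing Implicit Defensive.

Import Order.TTheory GRing.Theory Num.Theory.
Local Open Scope classical_set_scope.
Local Open Scope ring_scope.

(** * Positive semidefinite matrices: Gram factorizations and trace products *)

Section PsdMatrices.
Variable R : realType.
Implicit Types m n k : nat.

Lemma mxtrace_trmul n m (A B : 'M[R]_(m, n)) :
  \tr (A^T *m B) = \sum_j \sum_i A i j * B i j.
Proof.
by apply: eq_bigr => j _; rewrite mxE; apply: eq_bigr => i _; rewrite mxE.
Qed.

Lemma mxtrace_gram_ge0 n m (A : 'M[R]_(m, n)) : 0 <= \tr (A^T *m A).
Proof.
by rewrite mxtrace_trmul; do 2!apply: sumr_ge0 => ? _; rewrite -expr2 sqr_ge0.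
Qed.

Lemma mxtrace_gram_eq0 n m (A : 'M[R]_(m, n)) : \tr (A^T *m A) = 0 -> A = 0.
Proof.
have sq_ge0 i j : 0 <= A i j * A i j by rewrite -expr2 sqr_ge0.
rewrite mxtrace_trmul => /psumr_eq0P A0; apply/matrixP => i j.
have /psumr_eq0P -/(_ _ i isT)/eqP :=
  A0 (fun j _ => sumr_ge0 _ (fun i _ => sq_ge0 i j)) j isT.
by rewrite mulf_eq0 orbb mxE => Aij0; apply/eqP/Aij0.
Qed.

(** [B *m A] times its transpose is [B *m (A *m A^T) *m B^T = 0], so the Frobenius norm of [B *m A]
    vanishes. *)
Lemma mulmx_gram_eq0 n m k (A : 'M[R]_(m, n)) (B : 'M_(k, m)) :
  B *m (A *m A^T) = 0 -> B *m A = 0.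
Proof.
move=> BAA; apply: trmx_inj; rewrite trmx0; apply: mxtrace_gram_eq0.
by rewrite trmxK trmx_mul mulmxA -(mulmxA B) BAA mul0mx mxtrace0.
Qed.

(** [mulmx_gram_eq0] puts the left kernel of [A *m A^T] inside that of [A], which gives the
    nontrivial inequality. *)
Lemma mxrank_gram n m (A : 'M[R]_(m, n)) : \rank (A *m A^T) = \rank A.
Proof.
apply/eqP; rewrite eqn_leq mxrankM_maxl /=.
have: (kermx (A *m A^T) <= kermx A)%MS.
  by apply/sub_kermxP/mulmx_gram_eq0/sub_kermxP.
by move/mxrankS; rewrite !mxrank_ker leq_sub2lE // rank_leq_row.
Qed.

Lemma psdmx_gram n k (P : 'M[R]_(k, n)) : psdmx (P^T *m P).
Proof.
split=> [|x]; first by rewrite trmx_mul trmxK.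
by rewrite -trace_mx11 mulmxA -mulmxA -trmx_mul mxtrace_gram_ge0.
Qed.

Lemma psdmx_diag_eq0 n (X : 'M[R]_n) :
  psdmx X -> (forall i, X i i = 0) -> X = 0.
Proof.
move=> [Xs Xp] X0; apply/matrixP => i j; rewrite [RHS]mxE.
have Xji : X j i = X i j by rewrite -{1}Xs mxE.
have E (k l : 'I_n) : delta_mx 0 k *m X *m delta_mx l 0 = (X k l)%:M :> 'M_1.
  by rewrite -rowE -colE; apply/matrixP => a b; rewrite !ord1 !mxE eqxx.
(* With a zero diagonal, the quadratic form at this test vector equals [- 2 * X i j ^+ 2]. *)
have := Xp (delta_mx i 0 - X i j *: delta_mx j 0).
rewrite [(_ - _)^T]linearB /= [(_ *: _)^T]linearZ /= !trmx_delta.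
rewrite mulmxBl -scalemxAl mulmxBr !mulmxBl -!scalemxAl -!scalemxAr !E !X0 Xji.
rewrite raddf0 !scaler0 subr0 sub0r !mxE mulr1n -opprD oppr_ge0 -mulr2n.
rewrite pmulrn_lle0 // -expr2 => le0; apply/eqP; rewrite -sqrf_eq0.
by rewrite eq_le le0 sqr_ge0.
Qed.

(* Splitting off the rank one matrix spanned by a row with nonzero diagonal
   entry lowers the rank and keeps the matrix psd (Schur complement). *)
Lemma psdmx_factor n k (X : 'M[R]_n) :
  psdmx X -> (\rank X <= k)%N -> exists P : 'M[R]_(k, n), X = P^T *m P.
Proof.
elim: k X => [|k IH] X Xpsd rX.
  exists 0; rewrite mulmx0; apply/eqP.
  by rewrite -mxrank_eq0 -leqn0.
have [X0|] := pselect (forall i, X i i = 0).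
  by exists 0; rewrite mulmx0; apply: psdmx_diag_eq0.
move=> /existsNP[i /eqP Xii0]; case: (Xpsd) => Xs Xp.
have E (m : nat) (A : 'M_(n, m)) :
    delta_mx i i *m X *m (delta_mx i i *m A) = X i i *: (delta_mx i i *m A).
  rewrite -{1}(@mul_delta_mx _ n 1 n 0 i i) -(@mul_delta_mx _ n 1 n 0 i i).
  rewrite -!mulmxA (mulmxA (delta_mx 0 i) X) -rowE.
  rewrite (mulmxA _ (delta_mx i 0)) -colE.
  by rewrite [col i _]mx11_scalar mul_scalar_mx -!scalemxAr !mxE.
have Xii_gt0 : 0 < X i i.
  have := Xp (delta_mx i 0); rewrite trmx_delta -rowE -colE !mxE => ?.
  by rewrite lt_def Xii0.
set c := (X i i)^-1.
(* [C] is the column operation that clears row and column [i]. Since row [i] of [X *m C] is zero,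
   [X *m C] equals the congruence [C^T *m X *m C], which is psd. *)
pose C := 1%:M - c *: (delta_mx i i *m X).
pose X' := X *m C.
have X'E : X' = X - c *: ((row i X)^T *m row i X).
  rewrite /X' /C mulmxBr mulmx1 -scalemxAr rowE trmx_mul Xs trmx_delta.
  by rewrite -(@mul_delta_mx _ n 1 n 0 i i) !mulmxA.
have eX' : delta_mx i i *m X' = 0.
  rewrite /X' /C mulmxA mulmxBr mulmx1 -scalemxAr E scalerA mulVf //.
  by rewrite scale1r subrr.
have X'C : X' = C^T *m X *m C.
  rewrite -mulmxA -/X' /C linearB /= trmx1 linearZ /= trmx_mul Xs trmx_delta.
  by rewrite mulmxBl mul1mx -scalemxAl -mulmxA eX' mulmx0 scaler0 subr0.
have X'psd : psdmx X'.
  split=> [|x]; first by rewrite X'C !trmx_mul trmxK Xs mulmxA.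
  by have := Xp (C *m x); rewrite X'C trmx_mul !mulmxA.
have rX' : (\rank X' < \rank X)%N.
  (* The left kernel grows strictly: it gains the [i]-th unit vector, which is not in that of [X]
     because [X i i != 0]. *)
  have : (\rank (kermx X) < \rank (kermx X'))%N.
    apply: rank_ltmx; rewrite ltmxE; apply/andP; split.
      by apply/sub_kermxP; rewrite mulmxA mulmx_ker mul0mx.
    apply/negP => kk.
    have /sub_kermxP/row_matrixP/(_ i) : (delta_mx i i <= kermx X)%MS.
      by apply: submx_trans kk; apply/sub_kermxP.
    move/rowP/(_ i); rewrite row_mul -(@mul_delta_mx _ n 1 n 0 i i) row_mul.
    rewrite -mulmxA -rowE mxE big_ord1 !mxE !eqxx mul1r => /eqP.
    by rewrite (negPf Xii0).
  by rewrite !mxrank_ker ltn_sub2lE // rank_leq_row.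
have [P' P'E] := IH X' X'psd (leq_trans rX' rX).
(* The extra row contributes exactly the rank one term that was subtracted from [X]. *)
exists (col_mx (Num.sqrt c *: row i X : 'M_(1, n)) P').
rewrite (@tr_col_mx _ 1 k) (@mul_row_col _ _ 1 k) [(_ *: _)^T]linearZ /=.
rewrite -scalemxAl -scalemxAr scalerA -expr2 sqr_sqrtr ?invr_ge0 ?ltW //.
by rewrite -P'E X'E addrC subrK.
Qed.

(** Turns the inner product of two factored psd matrices into a squared Frobenius norm, so that it
    is nonnegative and vanishes only if [S *m P^T = 0]. *)
Lemma mxtrace_mul_gram m n k (S : 'M[R]_(m, n)) (P : 'M_(k, n)) :
  \tr (S^T *m S *m (P^T *m P)) = \tr ((S *m P^T)^T *m (S *m P^T)).
Proof. by rewrite trmx_mul trmxK !mulmxA mxtrace_mulC !mulmxA. Qed.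

Lemma psdmx_mxtrace_ge0 n (Z X : 'M[R]_n) :
  psdmx Z -> psdmx X -> 0 <= \tr (Z *m X).
Proof.
move=> /psdmx_factor -/(_ _ (rank_leq_row Z))[S ->].
move=> /psdmx_factor -/(_ _ (rank_leq_row X))[P ->].
by rewrite mxtrace_mul_gram mxtrace_gram_ge0.
Qed.

Lemma psdmx_mxtrace_eq0 n (Z X : 'M[R]_n) :
  psdmx Z -> psdmx X -> \tr (Z *m X) = 0 -> Z *m X = 0.
Proof.
move=> /psdmx_factor -/(_ _ (rank_leq_row Z))[S ->].
move=> /psdmx_factor -/(_ _ (rank_leq_row X))[P ->].
rewrite mxtrace_mul_gram => /mxtrace_gram_eq0 SP0.
by rewrite mulmxA -(mulmxA _ S) SP0 mulmx0 mul0mx.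
Qed.
End PsdMatrices.

(** * The span of the [E_ij], the tangent space and the Strong Arnold Property *)

Section Sap.
Variables (R : realType) (n : nat) (e : rel 'I_n).
Implicit Types (M X Y Z Q : 'M[R]_n) (a y : {ffun VE e -> R}).

Lemma trmx_Emx (i j : 'I_n) : (Emx R i j)^T = Emx R i j.
Proof. by rewrite /Emx linearZ linearD /= !trmx_delta addrC. Qed.

Lemma mxtrace_Emx (i j : 'I_n) X : X^T = X -> \tr (Emx R i j *m X) = X i j.
Proof.
have E (k l : 'I_n) : \tr (delta_mx k l *m X) = X l k.
  rewrite -(@mul_delta_mx _ n 1 n 0) -mulmxA mxtrace_mulC -rowE -colE.
  by rewrite trace_mx11 !mxE.
move=> Xs; rewrite -scalemxAl linearZ mulmxDl linearD /= !E -{1}Xs mxE.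
by rewrite -mulr2n -(mulr_natl (X i j)) mulrA mulVf ?mul1r // pnatr_eq0.
Qed.

Lemma mxtrace_sum_EVE y a X : X^T = X ->
  (forall p : VE e, X (end1 p) (end2 p) = a p) ->
  \tr ((\sum_p y p *: EVE R p) *m X) = dual_value a y.
Proof.
move=> Xs Xa; rewrite mulmx_suml raddf_sum /=; apply: eq_bigr => p _.
by rewrite -scalemxAl linearZ /= mxtrace_Emx // Xa.
Qed.

Lemma linEP L : L \in linE R e <-> exists y, L = \sum_p y p *: EVE R p.
Proof.
rewrite /linE span_def big_map big_enum /=; split.
  move=> /memv_sumP[v vE ->].
  have /choice[c cE] p : exists c, v p = c *: EVE R p by apply/vlineP/vE.
  by exists [ffun p => c p]; apply: eq_bigr => p _; rewrite ffunE cE.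
case=> y ->; apply: memv_sumr => p _; exact/memvZ/memv_line.
Qed.

Lemma trmx_linE L : L \in linE R e -> L^T = L.
Proof.
move=> /linEP[y ->]; rewrite linear_sum /=.
by apply: eq_bigr => p _; rewrite linearZ /= trmx_Emx.
Qed.

Lemma mxtrace_linE L Y : L \in linE R e -> Y^T = Y ->
  (forall p : VE e, Y (end1 p) (end2 p) = 0) -> \tr (L *m Y) = 0.
Proof.
move=> /linEP[y ->] Ys Y0; rewrite (@mxtrace_sum_EVE y [ffun=> 0]) //.
  by rewrite /dual_value big1 // => p _; rewrite ffunE mulr0.
by move=> p; rewrite ffunE.
Qed.

(** Trades the cast block form for a condition on entries, so that later arguments about the tangent
    space need no casts. *)
Lemma castmx_tangent_blockP (r s : nat) (h : (r + s = n)%N) Z :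
  (exists (U : 'M_r) (W : 'M_(r, s)),
     U^T = U /\ Z = castmx (h, h) (tangent_block U W)) <->
  Z^T = Z /\ forall i j : 'I_n, (r <= i)%N -> (r <= j)%N -> Z i j = 0.
Proof.
move: Z; case: n / h => Z; split=> [[U [W [Us ->]]]|[Zs Z0]].
  rewrite castmx_id /tangent_block; split.
    by rewrite tr_block_mx Us trmx0 trmxK.
  move=> i j; case: (splitP i) => [k ->|k ik _].
    by rewrite leqNgt ltn_ord.
  case: (splitP j) => [l -> |l jl _]; first by rewrite leqNgt ltn_ord.
  have -> : i = rshift r k by apply: val_inj.
  have -> : j = rshift r l by apply: val_inj.
  by rewrite block_mxEdr mxE.
exists (ulsubmx Z), (ursubmx Z); split; first by rewrite -[in RHS]Zs trmx_ulsub.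
rewrite castmx_id -{1}[Z]submxK /tangent_block; congr block_mx.
  by rewrite -{1}Zs trmx_ursub.
by apply/matrixP => i j; rewrite !mxE Z0 ?leq_addr.
Qed.

Lemma trmx_tangent M X : tangent_space M X -> X^T = X.
Proof.
case=> Q [d [U [W [_ Us ->]]]].
set T := castmx _ _; have [Ts _] := (castmx_tangent_blockP _ T).1
  (ex_intro _ U (ex_intro _ W (conj Us erefl))).
by rewrite !trmx_mul trmxK Ts mulmxA.
Qed.

(** In an eigenbasis of [M], the equation [M *m Y = 0] confines [Y] to the lower right block, which
    is where the tangent space vanishes. *)
Lemma mxtrace_tangent M X Y : tangent_space M X -> Y^T = Y ->
  M *m Y = 0 -> \tr (X *m Y) = 0.
Proof.
case=> Q [d [U [W [[QQ dE ME] Us ->]]]] Ys MY.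
set T := castmx _ _; have [_ T0] := (castmx_tangent_blockP _ T).1
  (ex_intro _ U (ex_intro _ W (conj Us erefl))).
pose B := Q^T *m Y *m Q.
have Bs : B^T = B by rewrite /B !trmx_mul trmxK Ys mulmxA.
have dB : diag_mx d *m B = 0.
  have -> : diag_mx d = Q^T *m M *m Q.
    by rewrite ME !mulmxA QQ mul1mx -mulmxA QQ mulmx1.
  have QQ' : Q *m Q^T = 1%:M by apply: mulmx1C.
  by rewrite /B !mulmxA -(mulmxA _ Q) QQ' mulmx1 -(mulmxA _ M) MY mulmx0 mul0mx.
have B0 (i j : 'I_n) : (i < \rank M)%N -> B i j = 0.
  move=> ir; have /matrixP/(_ i j)/eqP := dB.
  rewrite mul_diag_mx mxE [eqbRHS]mxE mulf_eq0.
  by rewrite (negPf (_ : d 0 i != 0)) ?dE // => /eqP.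
have -> : \tr (Q *m T *m Q^T *m Y) = \tr (B^T *m T).
  by rewrite Bs -!mulmxA mxtrace_mulC -!mulmxA mxtrace_mulC /B !mulmxA.
rewrite mxtrace_trmul; apply: big1 => j _; apply: big1 => i _.
have [ir|ri] := ltnP i (\rank M); first by rewrite B0 // mul0r.
have [jr|rj] := ltnP j (\rank M); first by rewrite -Bs mxE B0 // mul0r.
by rewrite T0 // mulr0.
Qed.

(** [Y] is orthogonal to the tangent space and to [linE R e]. By the SAP these sum to all symmetric
    matrices, so [Y] is orthogonal to itself. *)
Lemma SAP_unique M Y : has_SAP e M -> Y^T = Y -> M *m Y = 0 ->
  (forall p : VE e, Y (end1 p) (end2 p) = 0) -> Y = 0.
Proof.
move=> SAP Ys MY Y0; apply: mxtrace_gram_eq0; rewrite Ys.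
have : symmx Y by [].
rewrite -SAP => -[T MT [L /= eL YE]]; rewrite -{1}YE mulmxDl linearD /=.
by rewrite (mxtrace_tangent MT) // mxtrace_linE // addr0.
Qed.

(** * Coordinates of C(G) with respect to the [E_ij] *)

Lemma mx_VE_eq0 (Y : 'M[R]_n) : symmetric e -> Y^T = Y ->
  (forall p : VE e, Y (end1 p) (end2 p) = 0) ->
  (forall i j, i != j -> ~~ e i j -> Y i j = 0) -> Y = 0.
Proof.
move=> es Ys Y0 Y1; apply/matrixP => i j; rewrite mxE.
have [ij|ij] := boolP ((i == j) || e i j); last first.
  by move: ij; rewrite negb_or => /andP[]; apply: Y1.
have [le|/ltnW le] := leqP i j.
  have p : VE_pred e (i, j) by rewrite /VE_pred le.
  exact: (Y0 (exist _ (i, j) p)).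
(* [VE] stores only ordered pairs, so an entry below the diagonal is read off its transpose. *)
have p : VE_pred e (j, i) by rewrite /VE_pred /= le eq_sym es.
by rewrite -Ys mxE; exact: (Y0 (exist _ (j, i) p)).
Qed.

Lemma EVE_entry (p q : VE e) : EVE R q (end1 p) (end2 p) =
  if q == p then (if end1 p == end2 p then 1 else 2^-1) else 0.
Proof.
have /andP[lep _] := valP p; have /andP[leq _] := valP q.
rewrite -(inj_eq val_inj) /EVE /Emx /end1 /end2 !mxE.
case: (val p) (val q) lep leq => [p1 p2] [q1 q2] /= lep leq.
(* Both pairs are ordered, so the transposed unit matrix in [Emx] meets position [p] only when
   [p = q] is a diagonal pair. *)
have -> : (p1 == q2) && (p2 == q1) = [&& p1 == q1, p2 == q2 & p1 == p2].
  apply/andP/and3P => [[/eqP p1E /eqP p2E]|[/eqP <- /eqP <- /eqP ->]] //.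
  have q12 : q1 = q2 by apply/val_inj/anti_leq; rewrite leq -p1E -p2E.
  by rewrite p1E p2E q12.
rewrite xpair_eqE ![q1 == _]eq_sym ![q2 == _]eq_sym.
have [_|] := eqVneq p1 q1; have [_|] := eqVneq p2 q2 => //=;
  rewrite ?addr0 ?mulr0 //.
by case: eqVneq => _; rewrite ?addr0 ?mulr1 // -mulr2n mulVf // pnatr_eq0.
Qed.

Hypothesis e_sym : symmetric e.

Lemma sum_EVE_Cmx y : Cmx e (\sum_p y p *: EVE R p).
Proof.
have yL : \sum_p y p *: EVE R p \in linE R e by apply/linEP; exists y.
split=> [|i j ij nij]; first exact: trmx_linE.
rewrite mxtrace_mulC mxtrace_linE ?trmx_Emx // => p.
rewrite /Emx !mxE; have /andP[_] := valP p; rewrite -/(end1 p) -/(end2 p).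
(* No position of [VE e], nor its transpose, can be the nonadjacent pair [(i, j)]. *)
have E k l : (k == l) || e k l -> ~~ ((k == i) && (l == j)).
  by apply: contraTN => /andP[/eqP-> /eqP->]; rewrite negb_or ij.
move=> ep; rewrite (negPf (E _ _ ep)) andbC (negPf (E _ _ _)) ?addr0 ?mulr0 //.
by rewrite eq_sym e_sym.
Qed.

Lemma Cmx_sum_EVE Z :
  Cmx e Z -> exists y, \sum_p y p *: EVE R p = Z.
Proof.
move=> [Zs Z0].
(* The factor 2 on edges compensates for the off-diagonal entries 1/2 of [Emx]. *)
exists [ffun p : VE e =>
  (if end1 p == end2 p then 1 else 2) * Z (end1 p) (end2 p)].
set y := finfun _; have [Ys Y0] := sum_EVE_Cmx y.
apply/subr0_eq/mx_VE_eq0 => // [|p|i j ij nij].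
- by rewrite linearB /= Ys Zs.
- rewrite !mxE summxE (bigD1 p) //= big1 ?addr0 => [|q qp]; last first.
    by rewrite mxE EVE_entry (negPf qp) mulr0.
  rewrite mxE EVE_entry eqxx ffunE mulrAC.
  by case: ifP => _; rewrite ?mulr1 ?divff ?pnatr_eq0 // mul1r subrr.
by rewrite 2!mxE -!mxtrace_Emx // Z0 // Y0 // subrr.
Qed.

End Sap.

(** * Gram dimension, duality and the two inequalities *)

Section GramDimension.
Variables (R : realType) (n : nat) (e : rel 'I_n).
Implicit Types (M X Y Z : 'M[R]_n) (a y : {ffun VE e -> R}).

Lemma gram_representableP a k : gram_representable a k <->
  (0 < k)%N /\ exists P : 'M[R]_(k, n),
    forall p : VE e, (P^T *m P) (end1 p) (end2 p) = a p.
Proof.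
have E (P : 'M[R]_(k, n)) i j : (P^T *m P) i j = ((col i P)^T *m col j P) 0 0.
  by rewrite !mxE; apply: eq_bigr => l _; rewrite !mxE.
split=> -[k0 [u ua]]; split=> //.
  exists (\matrix_(l, j) u j l 0) => p; rewrite E -ua.
  suff colu j : col j (\matrix_(l, j) u j l 0) = u j by rewrite !colu.
  by apply/colP => l; rewrite !mxE.
by exists (fun i => col i u) => p; rewrite -E ua.
Qed.

Lemma gram_representable_rank a X k : psdmx X ->
  (forall p : VE e, X (end1 p) (end2 p) = a p) ->
  (0 < k)%N -> (\rank X <= k)%N -> gram_representable a k.
Proof.
move=> Xpsd Xa k0 /(psdmx_factor Xpsd)[P XE]; apply/gram_representableP.
by split=> //; exists P; rewrite -XE.
Qed.

(** One representation makes the least size exist, so [xget] does not fall back on its default 0. *)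
Lemma gram_dimP a k : gram_representable a k ->
  gram_representable a (gram_dim a) /\ (gram_dim a <= k)%N.
Proof.
move=> ak; have exP : exists k, `[< gram_representable a k >].
  by exists k; apply/asboolP.
have minP : exists m, gram_representable a m /\
    forall l, gram_representable a l -> (m <= l)%N.
  case: (ex_minnP exP) => m /asboolP am mmin.
  by exists m; split=> // l al; apply/mmin/asboolP.
by have [ga gmin] := xgetPex 0%N minP; split; [exact: ga|exact: gmin].
Qed.

(** Weak duality: the dual value is the inner product of [Z] with any psd completion. *)
Lemma dual_value_ge0 a y Z X : dual_feasible y Z -> psdmx X ->
  (forall p : VE e, X (end1 p) (end2 p) = a p) -> 0 <= dual_value a y.
Proof.
move=> [ZE Zpsd] Xpsd Xa; have [Xs _] := Xpsd.
by rewrite -(mxtrace_sum_EVE y Xs Xa) ZE psdmx_mxtrace_ge0.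
Qed.

Lemma complementary_slackness a y Z X : dual_optimal a y Z -> psdmx X ->
  (forall p : VE e, X (end1 p) (end2 p) = a p) -> Z *m X = 0.
Proof.
move=> [yZ yopt] Xpsd Xa; have [Xs _] := Xpsd; have [ZE Zpsd] := yZ.
apply: psdmx_mxtrace_eq0 => //; apply/eqP; rewrite eq_le psdmx_mxtrace_ge0 //.
rewrite -ZE (mxtrace_sum_EVE y Xs Xa) andbT.
(* The zero solution is dual feasible, which bounds the optimal value above by 0. *)
have <- : dual_value a [ffun=> 0] = 0.
  by apply: big1 => p _; rewrite ffunE mul0r.
apply: (yopt _ 0); split.
  by apply: big1 => p _; rewrite ffunE scale0r.
by rewrite -(mulmx0 n (0 : 'M[R]_n)^T); apply: psdmx_gram.
Qed.

(** After transposition [X *m Z = 0], so the rows of [X] lie in the row kernel of [Z]. *)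
Lemma mxrank_le_corank Z X : Z^T = Z -> X^T = X -> Z *m X = 0 ->
  (\rank X <= corank Z)%N.
Proof.
move=> Zs Xs ZX; apply/mxrankS/sub_kermxP/trmx_inj.
by rewrite trmx_mul Zs Xs ZX trmx0.
Qed.

Lemma corank_le_nu_eq M : Cmx e M -> psdmx M -> has_SAP e M ->
  (corank M <= nu_eq R e)%N.
Proof.
move=> MC Mpsd MS; have cM : (corank M < n.+1)%N by rewrite ltnS rank_leq_row.
apply: (@leq_bigmax_cond _ _ (fun k : 'I_n.+1 => k : nat) (Ordinal cM)).
by apply/asboolP; exists M.
Qed.

Hypothesis e_sym : symmetric e.

Lemma gram_dim_le_nu_eq a : (0 < nu_eq R e)%N -> Dset a ->
  (gram_dim a <= nu_eq R e)%N.
Proof.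
move=> nu0 [[X [Xpsd Xa]] [y [Z [opt nd]]]].
have ZX := complementary_slackness opt Xpsd Xa.
have [[ZE Zpsd] _] := opt.
(* The size used is [nu_eq R e] rather than [\rank X], since the rank may be 0 while Gram vectors
   need size at least 1. *)
apply: (gram_dimP _).2; apply: (gram_representable_rank Xpsd Xa nu0).
apply: leq_trans (mxrank_le_corank Zpsd.1 Xpsd.1 ZX) _.
(* Nondegeneracy of [Z] is literally its SAP, and [ZE] places [Z] in C(G). *)
by apply: corank_le_nu_eq; rewrite -?ZE //; [exact: sum_EVE_Cmx|rewrite ZE..].
Qed.

Lemma corank_gram_dim M : (0 < corank M)%N -> Cmx e M -> psdmx M ->
  has_SAP e M -> exists2 a : {ffun VE e -> R}, Dset a & gram_dim a = corank M.
Proof.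
move=> k0 MC Mpsd SAP; have [Ms _] := Mpsd.
pose P := row_base (kermx M).
have MP : M *m P^T = 0.
  apply: trmx_inj; rewrite trmx_mul trmxK Ms trmx0.
  by apply/sub_kermxP; rewrite eq_row_base.
pose X := P^T *m P.
have MX : M *m X = 0 by rewrite mulmxA MP mul0mx.
have Xpsd : psdmx X := psdmx_gram P.
pose a := [ffun p : VE e => X (end1 p) (end2 p)].
have Xa p : X (end1 p) (end2 p) = a p by rewrite ffunE.
have [y yM] := Cmx_sum_EVE e_sym MC.
(* [M] has dual value [\tr (M *m X) = 0], the lower bound given by weak duality. *)
have opt : dual_optimal a y M.
  split=> // y' Z' y'Z'; rewrite -(mxtrace_sum_EVE y Xpsd.1 Xa) yM MX mxtrace0.
  exact: dual_value_ge0 y'Z' Xpsd Xa.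
have rX : \rank X = corank M.
  by rewrite /X -{2}[P]trmxK mxrank_gram mxrank_tr eq_row_base.
exists a; first by split; [exists X|exists y, M].
have aM : gram_representable a (corank M).
  by apply: (gram_representable_rank Xpsd Xa); rewrite ?rX.
have [/gram_representableP[_ [K Ka]] le] := gram_dimP aM.
apply/eqP; rewrite eqn_leq le /= -rX.
(* [K] has [gram_dim a] rows, so identifying its Gram matrix with [X] bounds [\rank X] by
   [gram_dim a]. *)
suff -> : X = K^T *m K by apply: leq_trans (mxrankM_maxr _ _) (rank_leq_row _).
have Kpsd := psdmx_gram K.
apply/subr0_eq/(SAP_unique SAP) => [||p].
- by rewrite linearB /= Xpsd.1 Kpsd.1.
(* Complementary slackness applies to every psd completion, hence also to [K^T *m K]. *)
- by rewrite mulmxBr MX (complementary_slackness opt Kpsd Ka) subrr.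
by rewrite mxE [X in _ + X]mxE Xa Ka subrr.
Qed.

End GramDimension.

(* diag(1, ..., 1, 0) has corank one and the SAP for every graph. *)
Lemma nu_eq_gt0 (R : realType) (n : nat) (e : rel 'I_n) :
  (0 < n)%N -> (0 < nu_eq R e)%N.
Proof.
case: n e => // n e _; pose M : 'M[R]_n.+1 := pid_mx n.
have rM : \rank M = n by rewrite /M rank_pid_mx.
have Mpsd : psdmx M.
  have -> : M = M^T *m M by rewrite tr_pid_mx pid_mx_id.
  exact: psdmx_gram.
have [Ms _] := Mpsd.
have <- : corank M = 1%N by rewrite /corank mxrank_ker rM subSnn.
apply: corank_le_nu_eq => //.
  split=> // i j ij _; rewrite mxtrace_Emx // mxE.
  by rewrite (inj_eq val_inj) (negPf ij).
rewrite /has_SAP; apply/seteqP; split=> [_ [X XM [Y YL <-]]|S Ss].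
  by rewrite /symmx /= linearD /= (trmx_tangent XM) (trmx_linE YL).
(* The tangent space misses only the last diagonal entry, and the diagonal pair of [ord_max] is in
   [VE e] for every graph. Subtracting a multiple of its [EVE] clears that entry of [S]. *)
have pD : VE_pred e (ord_max, ord_max) by rewrite /VE_pred leqnn eqxx.
pose p : VE e := exist _ (ord_max, ord_max) pD.
pose D : 'M[R]_n.+1 := EVE R p.
have D1 : D ord_max ord_max = 1 by rewrite [LHS](EVE_entry R p p) !eqxx.
have DL : S ord_max ord_max *: D \in linE R e.
  by apply/memvZ/memv_span/map_f; rewrite mem_enum.
exists (S - S ord_max ord_max *: D); last first.
  by exists (S ord_max ord_max *: D) => //; rewrite subrK.
have [|U [W [Us TE]]] := (castmx_tangent_blockP (subnKC (rank_leq_row M))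
    (S - S ord_max ord_max *: D)).2.
  split=> [|i j]; first by rewrite linearB /= (trmx_linE DL) Ss.
  rewrite rM => ni nj; have -> : i = ord_max.
    by apply/val_inj/anti_leq; rewrite ni -ltnS ltn_ord.
  have -> : j = ord_max by apply/val_inj/anti_leq; rewrite nj -ltnS ltn_ord.
  by rewrite mxE [X in _ + X]mxE [X in _ - X]mxE D1 mulr1 subrr.
(* [M] is already diagonal with its nonzero entries first, so the identity serves as eigenbasis. *)
exists 1%:M, (\row_i (i < n)%:R), U, W; split=> //; last first.
  by rewrite -TE trmx1 mulmx1 mul1mx.
split=> [|i|]; first by rewrite trmx1 mulmx1.
  by rewrite mxE rM; case: ltnP; rewrite ?eqxx // oner_eq0.
rewrite trmx1 mulmx1 mul1mx; apply/matrixP => i j; rewrite !mxE.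
have [->|ij] := eqVneq i j; first by rewrite eqxx mulr1n.
by rewrite (inj_eq val_inj) (negPf ij) mulr0n.
Qed.

Lemma nu_eq_attained (R : realType) (n : nat) (e : rel 'I_n) :
  (0 < nu_eq R e)%N ->
  exists M : 'M[R]_n, [/\ Cmx e M, psdmx M, has_SAP e M & corank M = nu_eq R e].
Proof.
pose A := [pred k : 'I_n.+1 | `[< exists M : 'M[R]_n,
  [/\ Cmx e M, psdmx M, has_SAP e M & corank M = k] >]].
have nuE : nu_eq R e = \max_(k in A) k by [].
(* A maximum over no index would be 0, against the positivity assumed. *)
have [A0|/(eq_bigmax_cond (fun k : 'I_n.+1 => k : nat))[k]] := posnP #|A|.
  by rewrite nuE big_pred0 // => k; apply: card0_eq A0 k.
by rewrite -nuE => /asboolP[M Mk] -> _; exists M.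
Qed.

Theorem theorem5p9 (R : realType) (n : nat) (e : rel 'I_n)
    (n_gt0 : (0 < n)%N) (e_sym : symmetric e) (e_irr : irreflexive e) :
  is_max [set gram_dim a | a in @Dset R n e] (nu_eq R e).
Proof.
(* Positivity serves both halves: Gram dimensions are at least 1, and the maximum defining [nu_eq]
   must be attained. *)
have nu_gt0 := nu_eq_gt0 R e n_gt0; split=> [|_ [a aD <-]]; last first.
  exact: gram_dim_le_nu_eq.
have [M [MC Mpsd SAP Mnu]] := nu_eq_attained nu_gt0.
have := corank_gram_dim e_sym _ MC Mpsd SAP; rewrite Mnu => -[//|a aD anu].
by exists a.
Qed.
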